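(* Let $p$ be a prime, $n\ge 0$ an integer, $G$ a finite group, and $P$ a nonabelian Sylow $p$-subgroup of $G$. Suppose that $P$ has nilpotence class at most $n(p-1)+1$ and that $G$ has no nontrivial strongly closed abelian $p$-subgroup. Then $Z(P)$ has exponent at most $p^n$.
   Context: A subgroup $A \le P$ is strongly closed (in $P$ with respect to $G$) if for every $a\in A$ and $g\in G$ with $gag^{-1}\in P$, one has $gag^{-1}\in A$. *)

(* Defs.v *)
From mathcomp Require Import all_boot all_fingroup all_solvable.
Set Implicit Arguments. Unset Strict Implicit. Unset Printing Implicit Defensive.
Local Open Scope group_scope.

(* A \subset P is strongly closed in P with respect to G: for every a in A and
   g in G with g a g^-1 in P, g a g^-1 lies in A.  In mathcomp, x ^ y = y^-1 x y,
   so g a g^-1 = a ^ g^-1. *)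
Definition strongly_closed (gT : finGroupType) (A P G : {set gT}) : Prop :=
  A \subset P /\
  forall a g, a \in A -> g \in G -> a ^ g^-1 \in P -> a ^ g^-1 \in A.

(* Main.v *)
(* The subgroup A of p^n-th powers of elements of Z(P) is strongly closed, hence
   trivial.  The class bound enters as follows: if x^p centralises an abelian
   group V and (x - 1)^(n(p-1)+1) annihilates V, then [V, x] is a module over
   Z[zeta_p] killed by (zeta_p - 1)^(n(p-1)), an associate of p^n, so x
   centralises the p^n-th powers of V.
   An Alperin-type induction reduces strong closure to conjugating a in A by
   N_G(W), for W <= P containing a with N_P(W) Sylow in N_G(W).  A Frattini
   argument, applied to the centraliser K in N_G(W) of the N_G(W)-conjugates of
   a, replaces the conjugating element by one that normalises the subgroup
   generated by W and K :&: N_P(W).  When this subgroup is just W < P, we have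
   C_P(W) <= W, so a is a p^n-th power in Z(W), and the fact above with
   V = Z(W) shows that any x in N_P(W) outside W with x^p in W lies in K, a
   contradiction. *)
Require Import Defs.
From HB Require Import structures.
From mathcomp Require Import all_boot all_fingroup all_solvable.
From mathcomp Require Import ssralg.
Import GRing.Theory FiniteModule.
Local Open Scope group_scope.

(** * Additive maps [f] with [(1 + f)^p = 1] *)

Lemma iter_addf_binomial (M : zmodType) (f : {additive M -> M}) n (v : M) :
  iter n (fun u => u + f u)%R v = (\sum_(i < n.+1) iter i f v *+ 'C(n, i))%R.
Proof.
elim: n => [|n IHn]; first by rewrite big_ord1.
rewrite iterS IHn [RHS]big_ord_recl bin0 /=.
under [in RHS]eq_bigr => i _ do rewrite /bump leq0n add1n binS mulrnDr.
rewrite [in RHS]big_split addrA /=; congr (_ + _)%R; last first.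
  by rewrite raddf_sum; apply: eq_bigr => i _; rewrite raddfMn.
transitivity (\sum_(i < n.+2) iter i f v *+ 'C(n, i))%R; last first.
  by rewrite big_ord_recl bin0.
by rewrite [RHS]big_ord_recr /= bin_small // mulr0n addr0.
Qed.

(* Expanding (1 + f)^p = 1 at [v] gives, for [w = f v], that p w is
   - f^(p-1) w minus p times a combination of the f^j w with j > 0: on the image
   of [f], multiplication by p raises the degree in [f] by p - 1. *)
Lemma mulrn_image_eq0 (M : zmodType) (f : {additive M -> M}) p n v :
  prime p -> (forall u, iter p (fun u => u + f u)%R u = u) ->
  iter (n * (p - 1)) f (f v) = 0%R -> (f v *+ p ^ n = 0)%R.
Proof.
move=> p_pr fp1.
have iter0 j : iter j f 0%R = 0%R by elim: j => //= j ->; rewrite raddf0.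
have kill m m' w : m <= m' -> iter m f w = 0%R -> iter m' f w = 0%R.
  by move=> le_m w0; rewrite -(subnK le_m) iterD w0 iter0.
(* Strong induction on [m], bounded by [k]; [m] is freed from [n] since it need not drop by
   multiples of [p - 1]. *)
suff main : forall k m n v, m < k -> m <= n * (p - 1) ->
    iter m f (f v) = 0%R -> (f v *+ p ^ n = 0)%R.
  exact: (main (n * (p - 1)).+1).
case: p p_pr fp1 => [|[|q]] // p_pr fp1; rewrite subSS subn0.
elim=> // k IHk [|m] {}n {}v lt_mk le_m w0.
  by rewrite /= in w0; rewrite w0 mul0rn.
have vkill j : m.+2 <= j -> iter j f v = 0%R.
  by rewrite -iterSr in w0; move/kill; apply.
case: n le_m => [|n] le_m; first by rewrite mul0n in le_m.
have fv_p : (f v *+ q.+2 + \sum_(i < q) iter i.+2 f v *+ 'C(q.+2, i.+2)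
             + iter q.+2 f v = 0)%R.
  apply: (addrI v); rewrite addr0 -[RHS]fp1 iter_addf_binomial.
  rewrite 2!big_ord_recl big_ord_recr; congr (_ + _)%R.
  rewrite -[LHS]addrA; congr (_ + (_ + _))%R.
  - by rewrite -[in LHS](bin1 q.+2).
  - by rewrite -[LHS]mulr1n -[in LHS](binn q.+2).
have /(congr1 (fun x => x *+ q.+2 ^ n)%R) := fv_p.
rewrite /= mul0rn; set w := (f v *+ q.+2)%R.
(* The middle terms vanish: their binomial coefficients restore the factor [p], and [iter m f]
   already kills [iter i.+2 f v]. *)
rewrite 2!mulrnDl {}/w -mulrnA -expnS -sumrMnl big1 => [|i _]; last first.
  rewrite -mulrnA.
  have /dvdnP[c ->]: q.+2 %| 'C(q.+2, i.+2).
    by apply: prime_dvd_bin => //; exact: (ltn_ord i).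
  rewrite -mulnA -expnS mulnC mulrnA /= (IHk m) ?mul0rn ?(ltnW le_m) //.
  rewrite -!iterS -iterD; apply: vkill.
  by rewrite !addnS !ltnS leq_addr.
(* For the last term [m.+1] drops by [q.+1 = p - 1], so [n] factors [p] suffice. *)
rewrite addr0 (IHk (m.+1 - q.+1) n (iter q.+1 f v)) ?addr0 //.
- by rewrite subSS (leq_ltn_trans (leq_subr _ _)).
- by rewrite leq_subLR -mulSn.
rewrite -!iterS -iterD; apply: vkill.
by rewrite addnS ltnS addnC -leq_subLR.
Qed.

(** In additive notation, commutation with [x] on [V] is [f = x - 1], and [(1 + f)^p = 1] because
    [x ^+ p] centralises [V]; so [mulrn_image_eq0] applies. *)
Lemma commg_expg_eq1 (gT : finGroupType) (V : {group gT}) p n (v x : gT) :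
  prime p -> abelian V -> x \in 'N(V) -> x ^+ p \in 'C(V) -> v \in V ->
  iter (n * (p - 1)) (fun y => [~ y, x]) [~ v, x] = 1 ->
  [~ v ^+ (p ^ n), x] = 1.
Proof.
move=> p_pr abV nVx cVxp Vv v_x.
pose f (u : fmod_of abV) := (actr u x - u)%R.
have f_zmod : zmod_morphism f.
  by move=> u w; rewrite /f actAr actNr !opprD addrACA.
pose fA : {additive fmod_of abV -> fmod_of abV} :=
  HB.pack f (GRing.isZmodMorphism.Build _ _ f f_zmod).
have fE u : val (f u) = [~ val u, x].
  rewrite /f fmvalA fmvalN fmvalJ // commgEl.
  by apply: (centsP abV); rewrite ?memJ_norm ?groupV ?fmodP.
have iter_fE m u : val (iter m f u) = iter m (fun y => [~ y, x]) (val u).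
  by elim: m => [|m IHm] //; rewrite 2!iterS fE IHm.
have fp1 u : iter p (fun w => w + fA w)%R u = u.
  have addf m : iter m (fun w => w + fA w)%R u = actr u (x ^+ m).
    elim: m => [|m IHm]; first by rewrite actr1.
    by rewrite iterS IHm /= /f addrC subrK expgSr actrM ?groupX.
  rewrite addf; apply: val_inj; rewrite fmvalJ ?groupX //.
  by rewrite conjgE -(centP cVxp) ?fmodP // mulKg.
have fv0 : iter (n * (p - 1)) fA (fA (fmod abV v)) = 0%R.
  by apply: val_inj; rewrite /= iter_fE fE fmodK.
have:= mulrn_image_eq0 _ _ _ _ _ p_pr fp1 fv0; rewrite -raddfMn -fmodX //.
by move/(congr1 val); rewrite /= fE fmodK ?groupX.
Qed.

(** * Fusion in a Sylow subgroup *)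

(* Alperin-style reduction: conjugation inside [P] is generated by conjugation
   inside the normalisers of the fully normalised subgroups [W] of [P]; when
   handling [W], conjugation of larger subgroups may be assumed harmless. *)
Lemma conj_closed_ind (gT : finGroupType) p (G P : {group gT}) (A : {set gT}) :
  p.-Sylow(G) P ->
  let conj_closed (X : {group gT}) :=
    forall a g, a \in A -> a \in X -> g \in G -> X :^ g \subset P ->
    a ^ g \in A in
  (forall W : {group gT}, W \subset P -> p.-Sylow('N_G(W)) 'N_P(W) ->
     (forall X : {group gT}, X \subset P -> #|W| < #|X| -> conj_closed X) ->
     forall a g, a \in A -> a \in W -> g \in 'N_G(W) -> a ^ g \in A) ->
  forall X : {group gT}, X \subset P -> conj_closed X.
Proof.
move=> sylP conj_closed IHW X.
have [sPG pP _] := and3P sylP.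
have [k] := ubnP (#|P| - #|X|); elim: k X => // k IHk X ltk sXP.
have IH (Y : {group gT}) : Y \subset P -> #|X| < #|Y| -> conj_closed Y.
  move=> sYP ltXY; apply: IHk => //; rewrite -ltnS; apply: leq_trans ltk.
  by rewrite ltnS ltn_sub2l // (leq_trans ltXY) ?subset_leq_card.
have [eqXP | neXP] := eqVneq (X : {set gT}) P.
  move=> a g Aa Xa Gg sXgP; apply: (IHW P) => //.
  - rewrite (setIidPl (normG P)).
    by rewrite (pHall_subl _ (subsetIl _ _)) ?subsetI ?sPG ?normG.
  - by move=> Y sYP; rewrite ltnNge subset_leq_card.
  - by rewrite -eqXP.
  - by rewrite inE Gg inE -{1}eqXP.
have prXP (Y : {group gT}) : Y \subset P -> #|Y| = #|X| -> #|X| < #|'N_P(Y)|.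
  move=> sYP oY; rewrite -oY proper_card //.
  rewrite nilpotent_proper_norm ?(pgroup_nil pP) //.
  rewrite properEcard sYP oY ltn_neqAle subset_leq_card // andbT.
  by apply: contra neXP => /eqP oX; rewrite eqEcard sXP oX leqnn.
pose fits h := (h \in G) && (X :^ h \subset P).
have fits1 : fits 1 by rewrite /fits group1 conjsg1.
case: (arg_maxnP (fun h => #|'N_P(X :^ h)|) fits1) => w /andP[Gw sWP] maxW.
set W := (X :^ w)%G.
(* A Sylow overgroup [S] of ['N_P(W)] in ['N_G(W)] is carried into ['N_P(W :^ m)] by some [m], so by
   the choice of [w] it is no larger. *)
have sylW : p.-Sylow('N_G(W)) 'N_P(W).
  have pN : p.-group 'N_P(W) := pgroupS (subsetIl _ _) pP.
  have [S sylS sNS] := Sylow_superset (setSI 'N(W) sPG) pN.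
  have [sSN pS _] := and3P sylS.
  have [m Gm sSmP] := Sylow_Jsub sylP (subset_trans sSN (subsetIl _ _)) pS.
  have sWS : W \subset S.
    by apply: subset_trans sNS; rewrite subsetI sWP normG.
  have le_card : #|S| <= #|'N_P(W)|.
    rewrite -(cardJg S m); apply: leq_trans (maxW (w * m) _).
      rewrite subset_leq_card // subsetI sSmP conjsgM normJ conjSg.
      exact: subset_trans sSN (subsetIr _ _).
    rewrite /fits groupM //= conjsgM; apply: subset_trans sSmP.
    by rewrite conjSg.
  by have /eqP <- : S :==: 'N_P(W) by rewrite eq_sym eqEcard sNS.
(* Sylow's theorem in ['N_G(W)] corrects an element carrying [Y] to [W] so that it also carries
   ['N_P(Y)] into [P]. *)
have toW (Y : {group gT}) y : y \in G -> Y :=: X :^ y -> Y \subset P ->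
    exists h, [/\ h \in G, Y :^ h = W & 'N_P(Y) :^ h \subset P].
  move=> Gy defY sYP; pose h := y^-1 * w.
  have Gh : h \in G by rewrite groupM ?groupV.
  have defW : Y :^ h = W by rewrite defY -conjsgM mulKVg.
  have [||m] := @Sylow_Jsub _ _ _ _ ('N_P(Y) :^ h)%G sylW.
  - rewrite /= conjIg -normJ defW setSI //; exact: conj_subG.
  - by rewrite pgroupJ (pgroupS (subsetIl _ _) pP).
  case/setIP=> Gm nWm sNP; exists (h * m); split; first exact: groupM.
    by rewrite conjsgM defW (normP nWm).
  by rewrite conjsgM (subset_trans sNP) ?subsetIl.
move=> a g Aa Xa Gg sXgP.
have [h [Gh defW sNhP]] := toW X 1 (group1 _) (esym (conjsg1 _)) sXP.
have [h' [Gh' defW' sNhP']] := toW (X :^ g)%G g Gg erefl sXgP.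
have sub_norm (Y : {group gT}) : Y \subset P -> Y \subset 'N_P(Y).
  by move=> sYP; rewrite subsetI sYP normG.
(* Conjugate by [h], then by [h^-1 * g * h'] in ['N_G(W)], then by [h'^-1]; the outer two act on
   groups larger than [X]. *)
have Aah : a ^ h \in A.
  apply: (IH 'N_P(X)%G); rewrite ?subsetIl ?prXP //.
  exact: (subsetP (sub_norm _ sXP)).
have Wah : a ^ h \in W by rewrite -defW memJ_conjg.
have Aagh' : a ^ (g * h') \in A.
  rewrite -(mulKVg h (g * h')) conjgM; apply: (IHW W) => //.
    move=> Y sYP; rewrite cardJg; exact: IH.
  apply/setIP; split; first by rewrite !groupM ?groupV.
  by apply/normP; rewrite -{1}defW -conjsgM mulKVg conjsgM.
rewrite -[a ^ g](conjgK h') -(conjgM a).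
apply: (IH ('N_P(X :^ g) :^ h')%G) => //.
- by rewrite cardJg (prXP (X :^ g)%G) ?cardJg.
- rewrite conjgM memJ_conjg; apply: (subsetP (sub_norm (X :^ g)%G sXgP)).
  by rewrite memJ_conjg.
- by rewrite groupV.
- by rewrite conjsgK subsetIl.
Qed.

(** * Strong closure of the [p ^ n]-th powers in the centre *)

Lemma Mho_center_conj_closed (gT : finGroupType) p n (G P W : {group gT}) :
  prime p -> p.-group P -> nil_class P <= n * (p - 1) + 1 ->
  W \subset P -> p.-Sylow('N_G(W)) 'N_P(W) ->
  (forall X : {group gT}, X \subset P -> #|W| < #|X| ->
     forall a g, a \in 'Mho^n('Z(P)) -> a \in X -> g \in G ->
       X :^ g \subset P -> a ^ g \in 'Mho^n('Z(P))) ->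
  forall a g, a \in 'Mho^n('Z(P)) -> a \in W -> g \in 'N_G(W) ->
    a ^ g \in 'Mho^n('Z(P)).
Proof.
move=> p_pr pP clP sWP sylT IH a g Aa Wa NGg.
set H := 'N_G(W)%G; set T := 'N_P(W)%G.
have [nWH nWT] : H \subset 'N(W) /\ T \subset 'N(W) by rewrite !subsetIr.
have [sTP sTH] := (subsetIl P 'N(W), pHall_sub sylT : T \subset H).
pose B := <<a ^: H>>%G.
have nBH : H \subset 'N(B) by rewrite norms_gen ?class_norm.
have sBW : B \subset W by rewrite gen_subG class_sub_norm.
pose K := 'C_H(B)%G.
have nsKH : K <| H by rewrite /normal subsetIl normsI ?normG ?norms_cent.
have sylT0 := Sylow_setI_normal nsKH sylT.
set T0 := (K :&: T)%G in sylT0.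
have /mulsgP[k m Kk /setIP[Hm nT0m] ->{g NGg}] : g \in K * 'N_H(T0).
  by rewrite (Frattini_arg nsKH sylT0).
have [Gm nWm] := setIP Hm.
have Ba : a \in B by rewrite mem_gen ?class_refl.
have -> : a ^ (k * m) = a ^ m.
  have /setIP[_ /centP/(_ a Ba) cak] := Kk.
  by rewrite conjgM [a ^ k]conjgE -cak mulKg.
have sT0P : T0 \subset P := subset_trans (subsetIr _ _) sTP.
have [sT0W | nsT0W] := boolP (T0 \subset W); last first.
  apply: (IH (W <*> T0)%G) => //.
  - by rewrite join_subG sWP.
  - apply: proper_card; rewrite properE joing_subl.
    by apply: contra nsT0W; apply: subset_trans; apply: joing_subr.
  - exact: (subsetP (joing_subl _ _)).
  - by rewrite /= conjYg (normP nWm) (normP nT0m) join_subG sWP.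
have [eqWP | neWP] := eqVneq (W : {set gT}) P.
  rewrite memJ_norm //.
  apply: subsetP nWm; rewrite eqWP.
  exact: char_norms (char_trans (Mho_char _ _) (center_char _)).
have prWT : W \proper T.
  rewrite nilpotent_proper_norm ?(pgroup_nil pP) //.
  by rewrite properEneq neWP.
have pT : p.-group T := pgroupS sTP pP.
have [x [Tx nWx Wxp]] : exists x, [/\ x \in T, x \notin W & x ^+ p \in W].
  have [_ [y Ty nWy]] := properP prWT.
  have [|j Wj minj] := @ex_minnP (fun j => y ^+ (p ^ j) \in W).
    have [e oy] := p_natP (mem_p_elt pT Ty).
    by exists e; rewrite -oy expg_order.
  case: j Wj minj => [|j] Wj minj; first by rewrite expg1 (negPf nWy) in Wj.
  exists (y ^+ (p ^ j)); split; first exact: groupX.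
    by apply/negP=> /minj; rewrite ltnn.
  by rewrite -expgM -expnSr.
case/negP: nWx; apply: (subsetP sT0W).
have [Hx Px] := (subsetP sTH x Tx, subsetP sTP x Tx).
(* As [B] lies in [W], ['C_P(W)] centralises [B] and so lies in [T0]. *)
have cWP : 'C_P(W) \subset W.
  apply/subsetP=> y /setIP[Py cWy]; apply: (subsetP sT0W).
  have Ty : y \in T by rewrite inE Py (subsetP (cent_sub _)).
  rewrite inE Ty inE (subsetP sTH) //= andbT.
  exact: (subsetP (centS sBW)) cWy.
have abZ := center_abelian P.
have pZ : p.-group 'Z(P) := pgroupS (center_sub P) pP.
have:= Aa; rewrite (MhoEabelian _ pZ abZ) => /imsetP[z Zz def_a].
have Vz : z \in 'Z(W).
  have [Pz cPz] := setIP Zz; have cWz := subsetP (centS sWP) z cPz.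
  by rewrite inE cWz (subsetP cWP) // inE Pz.
rewrite inE Tx inE Hx /= cent_gen andbT.
apply/centP=> _ /imsetP[h /setIP[_ nWh] ->]; apply/esym/commgP/eqP.
(* [h] normalises [W] but perhaps not [P], hence ['Z(W)] rather than ['Z(P)]. *)
have Vzh : z ^ h \in 'Z(W).
  by rewrite memJ_norm // (subsetP (char_norms (center_char W))).
rewrite def_a conjXg; apply: (commg_expg_eq1 _ 'Z(W)%G _ _ _ _ p_pr) => //.
- exact: center_abelian.
- by apply: subsetP (subsetP nWT x Tx); apply: char_norms (center_char W).
- by apply: subsetP Wxp; rewrite centsC subsetIr.
(* At [j = n * (p - 1)] this term has index [n * (p - 1) + 2], one above the class bound, so it is
   trivial. *)
have lcn_iter j : iter j (fun y => [~ y, x]) [~ z ^ h, x] \in 'L_j.+2(P).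
  have Pzh : z ^ h \in P by rewrite (subsetP sWP) // (subsetP (center_sub W)).
  by elim: j => [|j IHj]; rewrite lcnSn ?lcn1 mem_commg.
have := lcn_iter (n * (p - 1))%N; rewrite addn1 in clP.
by rewrite (lcn_nil_classP _ (pgroup_nil pP) clP) => /set1P.
Qed.

Lemma Mho_center_strongly_closed (gT : finGroupType) p n (G P : {group gT}) :
  prime p -> p.-Sylow(G) P -> nil_class P <= n * (p - 1) + 1 ->
  strongly_closed 'Mho^n('Z(P)) P G.
Proof.
move=> p_pr sylP clP.
have sAP : 'Mho^n('Z(P)) \subset P := subset_trans (Mho_sub _ _) (center_sub _).
split=> // a g Aa Gg Pag; have Pa := subsetP sAP a Aa.
(* For [X = <[a]>], the condition [X :^ g^-1 \subset P] just says [a ^ g^-1 \in P]. *)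
apply: (conj_closed_ind _ _ _ _ _ sylP _ <[a]>%G);
  rewrite ?cycle_subG ?cycle_id ?groupV //.
  by move=> W; apply: Mho_center_conj_closed => //; apply: pHall_pgroup sylP.
by rewrite -cycleJ cycle_subG.
Qed.

Theorem theorem1p4 (p n : nat) (gT : finGroupType) (G P : {group gT}) :
  prime p ->
  P \in 'Syl_p(G) ->
  ~~ abelian P ->
  nil_class P <= n * (p - 1) + 1 ->
  (forall A : {group gT}, A \subset P -> p.-group A -> abelian A ->
     strongly_closed A P G -> A :=: 1) ->
  exponent 'Z(P) <= p ^ n.
Proof.
move=> p_pr; rewrite inE => sylP _ clP no_sc.
have pP := pHall_pgroup sylP.
have abZ := center_abelian P.
have pZ : p.-group 'Z(P) := pgroupS (center_sub P) pP.
have A1 : 'Mho^n('Z(P)) = 1.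
  apply: (no_sc 'Mho^n('Z(P))%G).
  - exact: subset_trans (Mho_sub _ _) (center_sub _).
  - exact: pgroupS (Mho_sub _ _) pZ.
  - exact: abelianS (Mho_sub _ _) abZ.
  - exact: (Mho_center_strongly_closed _ p).
apply: dvdn_leq; first by rewrite expn_gt0 prime_gt0.
apply/exponentP=> z Zz; apply/set1gP; rewrite -A1 (MhoEabelian _ pZ abZ).
by apply/imsetP; exists z.
Qed.
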